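(* Let $s>2$ be a rational number that is not an integer, let $t>1$ be an integer with $p=st$ an integer, and write $q=\lceil s\rceil$. Let $\xi_1,\dots,\xi_q$ be positive integers with $\xi_{q-1}\binom{p-t}{(q-2)t+1}=\xi_q$, $\binom{p-t}{(r-1)t+1}\xi_r=\binom{p-t}{rt}\xi_{r+1}$ for $2\le r\le q-2$, and $(p-t)\xi_1=t\binom{p-t}{t}\xi_2$. Let $\mathcal{C}$ be the array code (over a finite field $\mathbb{F}$, with $t$ rows, entries in $\mathbb{F}^p$ with basis $x_1,\dots,x_p$) whose columns are: (Type $T_1$) for each $t$-subset $A\subseteq\{1,\dots,p\}$, $\xi_1$ columns with cells $x_a$, $a\in A$; (Type $T_r$, $2\le r\le q-1$) for each $(t-1)$-subset $B$ and each $((r-1)t+1)$-subset $C\subseteq\{1,\dots,p\}\setminus B$, $\xi_r$ columns with cells $x_b$ ($b\in B$) and one cell $\sum_{c\in C}x_c$; (Type $T_q$) for each $(t-1)$-subset $B$, $\xi_q$ columns with cells $x_b$ ($b\in B$) and one cell $\sum_{c\notin B}x_c$. Then for every $i\in\{1,\dots,p\}$, the columns of $\mathcal{C}$ that do not have a cell equal to $x_i$ can be partitioned into pairs such that, for each pair, $x_i$ lies in the linear span of the $2t$ cells of the two columns.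
   Context: Columns of an array code are called servers and its entries cells; a cell equal to a single basis vector $x_i$ is called a singleton. *)

(* Defs.v *)
From HB Require Import structures.
From mathcomp Require Import all_boot all_order all_algebra.
Set Implicit Arguments. Unset Strict Implicit. Unset Printing Implicit Defensive.
Import Order.TTheory GRing.Theory Num.Theory.
Local Open Scope ring_scope.

Definition xb (F : fieldType) (p : nat) (i : 'I_p) : 'rV[F]_p := delta_mx 0 i.

(* A column (server) is the list of its t cells. *)
Definition cols_T1 (F : fieldType) (p t : nat) (xi : nat -> nat)
  : seq (seq 'rV[F]_p) :=
  flatten [seq nseq (xi 1%N) [seq xb F a | a <- enum A]
          | A : {set 'I_p} <- enum [set A : {set 'I_p} | #|A| == t]].

Definition cols_Tr (F : fieldType) (p t : nat) (xi : nat -> nat) (r : nat)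
  : seq (seq 'rV[F]_p) :=
  flatten [seq nseq (xi r) (rcons [seq xb F b | b <- enum BC.1]
                                  (\sum_(c in BC.2) xb F c))
          | BC : {set 'I_p} * {set 'I_p} <- enum [set BC : {set 'I_p} * {set 'I_p} |
                        [&& #|BC.1| == t.-1, #|BC.2| == ((r.-1) * t).+1
                          & [disjoint BC.1 & BC.2]]]].

Definition cols_Tq (F : fieldType) (p t : nat) (xi : nat -> nat) (q : nat)
  : seq (seq 'rV[F]_p) :=
  flatten [seq nseq (xi q) (rcons [seq xb F b | b <- enum B]
                                  (\sum_(c in ~: B) xb F c))
          | B : {set 'I_p} <- enum [set B : {set 'I_p} | #|B| == t.-1]].

Definition array_code (F : fieldType) (p t q : nat) (xi : nat -> nat)
  : seq (seq 'rV[F]_p) :=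
  cols_T1 F p t xi
  ++ flatten [seq cols_Tr F p t xi r | r <- iota 2 (q - 2)]
  ++ cols_Tq F p t xi q.

(* Main.v *)
(* Describe a column by a pair (B, C) of disjoint sets: its singletons are the x_b with
   b in B, and it has one more cell, the sum of the x_c with c in C, when C is nonempty.
   Fix i. A column without the cell x_i either avoids i altogether or has i in its sum;
   the former, for type T_r, are paired with the latter, for type T_(r+1). A column (B, C)
   avoiding i and a column (B', i |: C') span x_i as soon as every point at which C and C'
   differ lies in B or B'. The permutations fixing i act transitively on the columns of
   either kind, so this compatibility relation is a biregular bipartite graph. The
   equations on xi say that its two sides, counted with multiplicity, have the same size,
   and Hall's theorem yields a perfect matching. *)
Require Import Defs.
From mathcomp Require Import all_boot all_order all_fingroup all_algebra zify.
Set Implicit Arguments. Unset Strict Implicit. Unset Printing Implicit Defensive.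
Import Order.TTheory GRing.Theory Num.Theory.

(** * Hall's theorem *)

Section Hall.
Variables (X Y : finType) (D : {set X}).
Implicit Types (N : X -> {set Y}) (S : {set X}).

Definition hall_condition N :=
  [forall S : {set X}, (S \subset D) ==> (#|S| <= #|\bigcup_(x in S) N x|)].

Lemma hall_conditionP N :
  reflect (forall S, S \subset D -> #|S| <= #|\bigcup_(x in S) N x|)
          (hall_condition N).
Proof.
apply: (iffP forallP) => [hallN S SD|hallN S]; last exact/implyP/hallN.
exact: (implyP (hallN S)).
Qed.

Lemma hall_condition_setD1 N x y : hall_condition N ->
  hall_condition [eta N with x |-> N x :\ y]
  \/ exists2 S : {set X}, (S \subset D) && (x \notin S)
      & #|N x :\ y :|: \bigcup_(z in S) N z| <= #|S|.
Proof.
move=> /hall_conditionP hallN; set N' := [eta N with _ |-> _].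
have N'E S : x \notin S -> \bigcup_(z in S) N' z = \bigcup_(z in S) N z.
  by move=> xS; apply: eq_bigr => z zS /=; case: eqP xS => // <-; rewrite zS.
have [|/forallPn[S]] := boolP (hall_condition N'); first by left.
rewrite negb_imply -ltnNge => /andP[SD]; have [xS|xS] := boolP (x \in S); last first.
  by rewrite N'E // ltnNge hallN.
rewrite (big_setD1 x xS) N'E ?setD11 //= eqxx (cardsD1 x S) xS => viol.
right; exists (S :\ x) => //.
by rewrite setD11 andbT (subset_trans (subsetDl _ _)).
Qed.

(* If both removals failed, the violating sets would contradict the submodularity of
   the cardinality of neighbourhoods. *)
Lemma hall_condition_setD1_or N x y1 y2 :
    hall_condition N -> x \in D -> y1 != y2 ->
  hall_condition [eta N with x |-> N x :\ y1]
  \/ hall_condition [eta N with x |-> N x :\ y2].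
Proof.
move=> hallN xD y12; have hallP := hall_conditionP _ hallN.
have [|[S1 /andP[S1D xS1] viol1]] := hall_condition_setD1 x y1 hallN; first by left.
have [|[S2 /andP[S2D xS2] viol2]] := hall_condition_setD1 x y2 hallN; first by right.
set U1 := _ :|: _ in viol1; set U2 := _ :|: _ in viol2.
have leU : #|S1 :|: S2|.+1 <= #|U1 :|: U2|.
  have -> : U1 :|: U2 = \bigcup_(z in x |: (S1 :|: S2)) N z.
    rewrite big_setU1 ?inE ?(negPf xS1) //= bigcup_setU setUACA -setDIr.
    suff -> : [set y1] :&: [set y2] = set0 by rewrite setD0.
    by apply/setP => y; rewrite !inE; case: eqP => // ->; apply: negPf y12.
  have := hallP (x |: (S1 :|: S2)).
  by rewrite cardsU1 inE negb_or xS1 xS2 !subUset sub1set xD S1D S2D; apply.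
have leI : #|S1 :&: S2| <= #|U1 :&: U2|.
  apply: leq_trans (hallP _ (subset_trans (subsetIl _ _) S1D)) _.
  apply: subset_leq_card; apply/bigcupsP => z /setIP[zS1 zS2].
  by rewrite subsetI !subsetU // (bigcup_sup z) ?orbT.
have := cardsUI U1 U2; have := cardsUI S1 S2; lia.
Qed.

Lemma hall_marriage N (y0 : Y) :
    hall_condition N ->
  exists2 f : X -> Y, {in D &, injective f} & {in D, forall x, f x \in N x}.
Proof.
have [n] := ubnP (\sum_(x in D) #|N x|); elim: n N => // n IHn N leN hallN.
have [/exists_inP[x xD /card_gt1P[y1 [y2 [y1N y2N y12]]]]|/exists_inPn le1] :=
    boolP [exists x in D, 1 < #|N x|].
  have remove y : y \in N x -> hall_condition [eta N with x |-> N x :\ y] ->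
      exists2 f : X -> Y, {in D &, injective f} & {in D, forall x, f x \in N x}.
    move=> yN /IHn[|f finj fN].
      move: leN; rewrite !(bigD1 x xD) /= eqxx (cardsD1 y (N x)) yN.
      rewrite ltnS; apply: leq_trans; rewrite ltnS leq_add2l leq_eqVlt; apply/orP; left.
      by apply/eqP/eq_bigr => z /andP[_ /negPf ->].
    exists f => // z zD; have := fN z zD; rewrite /=.
    by case: eqP => // ->; case/setD1P.
  by have [] := hall_condition_setD1_or hallN xD y12; apply: remove.
have /hall_conditionP hallP := hallN.
have N_single x : x \in D -> exists y, N x = [set y].
  move=> xD; apply/cards1P; have := hallP [set x]; rewrite sub1set xD cards1 big_set1.
  by have := le1 x xD; lia.
exists (fun x => odflt y0 [pick y in N x]) => [x x' xD x'D|x xD]; last first.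
  by case: pickP => //= N0; have [y Ny] := N_single x xD; have := N0 y; rewrite Ny set11.
have [[y Ny] [y' Ny']] := (N_single x xD, N_single x' x'D); rewrite Ny Ny'.
have pick1 z : odflt y0 [pick u in [set z]] = z.
  by case: pickP => [u /set1P //|/(_ z)]; rewrite set11.
rewrite !pick1 => yy'; apply: contraTeq (leqnn 1) => xx'.
have := hallP [set x; x']; rewrite subUset !sub1set xD x'D cards2 xx'.
by rewrite bigcup_setU !big_set1 Ny Ny' yy' setUid cards1 => /(_ isT).
Qed.

End Hall.

(** * Biregular bipartite graphs *)

Lemma double_count (X Y : finType) (S : {set X}) (T : {set Y}) (e : X -> Y -> bool) :
  \sum_(x in S) #|[set y in T | e x y]| = \sum_(y in T) #|[set x in S | e x y]|.
Proof.
have card_rel (Z : finType) (A : {set Z}) (P : pred Z) :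
    #|[set z in A | P z]| = \sum_(z in A) P z.
  by rewrite -sum1dep_card big_mkcondr.
rewrite (eq_bigr (fun x => \sum_(y in T) e x y)) => [|x _]; last exact: card_rel.
by rewrite exchange_big; apply: eq_bigr => y _; rewrite card_rel.
Qed.

Lemma perm_enum_imset (X Y : finType) (f : X -> Y) (S : {set X}) :
  {in S &, injective f} -> perm_eq (map f (enum S)) (enum (f @: S)).
Proof.
move=> finj; apply: uniq_perm => [||y]; last 2 first.
- exact: enum_uniq.
- rewrite mem_enum; apply/mapP/imsetP => -[x xS ->]; exists x => //.
    by rewrite -mem_enum.
  by rewrite mem_enum.
by rewrite map_inj_in_uniq ?enum_uniq // => x y; rewrite !mem_enum; apply: finj.
Qed.

Lemma regular_hall_condition (X Y : finType) (S : {set X}) (T : {set Y})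
    (e : X -> Y -> bool) d :
    0 < d ->
    {in S, forall x, d <= #|[set y in T | e x y]|} ->
    {in T, forall y, #|[set x in S | e x y]| <= d} ->
  hall_condition S (fun x => [set y in T | e x y]).
Proof.
move=> d_gt0 degS degT; apply/hall_conditionP => S' /subsetP S'S.
set N := \bigcup_(x in S') _.
have /subsetP NT : N \subset T by apply/bigcupsP => x _; apply/subsetP => y /setIdP[].
rewrite -(leq_pmul2r d_gt0) -!sum_nat_const.
apply: (@leq_trans (\sum_(x in S') #|[set y in N | e x y]|)).
  apply: leq_sum => x xS'; apply: leq_trans (degS x (S'S x xS')) _.
  apply/subset_leq_card/subsetP => y /setIdP[yT exy]; rewrite inE exy andbT.
  by apply/bigcupP; exists x; rewrite // inE yT.
rewrite double_count; apply: leq_sum => y /NT yT; apply: leq_trans (degT y yT).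
by apply/subset_leq_card/subsetP => x; rewrite !inE => /andP[/S'S ->].
Qed.

Lemma biregular_matching (X Y : finType) (S : {set X}) (T : {set Y})
    (e : X -> Y -> bool) dS dT :
    0 < dS -> #|S| = #|T| ->
    {in S, forall x, #|[set y in T | e x y]| = dS} ->
    {in T, forall y, #|[set x in S | e x y]| = dT} ->
  exists M : seq (X * Y),
    [/\ perm_eq (unzip1 M) (enum S), perm_eq (unzip2 M) (enum T)
      & all (fun z => e z.1 z.2) M].
Proof.
move=> dS_gt0 cST degS degT.
have [S0|[x0 x0S]] := set_0Vmem S.
  exists [::]; move/esym/eqP: cST.
  by rewrite S0 cards0 cards_eq0 => /eqP ->; rewrite !enum_set0.
have cT_gt0 : 0 < #|T| by rewrite -cST; apply/card_gt0P; exists x0.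
have dST : dS = dT.
  have := double_count S T e; rewrite (eq_bigr _ degS) (eq_bigr _ degT).
  by rewrite !sum_nat_const cST => /eqP; rewrite eqn_pmul2l // => /eqP.
have [y0 _] := card_gt0P cT_gt0.
have [||f finj fN] := hall_marriage y0 (@regular_hall_condition _ _ S T e dS dS_gt0 _ _).
- by move=> x /degS ->.
- by move=> y /degT ->; rewrite dST.
have {}fN x : x \in S -> f x \in T /\ e x (f x) by move=> /fN /setIdP.
exists [seq (x, f x) | x <- enum S]; split.
- by rewrite /unzip1 -map_comp map_id.
- rewrite /unzip2 -map_comp; apply: perm_trans (perm_enum_imset finj) _.
  suff -> : f @: S = T by [].
  apply/eqP; rewrite eqEcard card_in_imset // cST leqnn andbT.
  by apply/subsetP => _ /imsetP[x /fN[fT _] ->].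
by apply/allP => _ /mapP[x + ->]; rewrite mem_enum => /fN[].
Qed.

(** * Repeated sequences *)

Definition copies (U : Type) n (s : seq U) := flatten [seq nseq n x | x <- s].

Lemma map_copies (U V : Type) (f : U -> V) n s :
  map f (copies n s) = copies n (map f s).
Proof.
rewrite /copies map_flatten -!map_comp; congr flatten.
by apply: eq_map => x /=; rewrite map_nseq.
Qed.

Lemma filter_copies (U : Type) (P : pred U) n s :
  filter P (copies n s) = copies n (filter P s).
Proof.
elim: s => //= x s IH; rewrite /copies /= filter_cat filter_nseq -!/(copies _ _) IH.
by case: (P x); rewrite ?mul1n.
Qed.

Lemma copies_cat (U : Type) n (s1 s2 : seq U) :
  copies n (s1 ++ s2) = copies n s1 ++ copies n s2.
Proof. by rewrite /copies map_cat flatten_cat. Qed.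

Lemma perm_copies (U : eqType) n (s1 s2 : seq U) :
  perm_eq s1 s2 -> perm_eq (copies n s1) (copies n s2).
Proof. by move=> s12; apply: perm_flatten; apply: perm_map. Qed.

Lemma perm_copies_enum (X : finType) (S : {set X}) n :
  perm_eq [seq z.1 | z <- enum (setX S [set: 'I_n])] (copies n (enum S)).
Proof.
have -> : copies n (enum S)
    = [seq z.1 | z <- [seq (x, k) | x <- enum S, k <- enum 'I_n]].
  rewrite map_allpairs /copies; congr flatten; apply: eq_map => x /=.
  by rewrite -[in LHS](size_enum_ord n); elim: (enum _) => //= _ s ->.
apply: perm_map; apply: uniq_perm => [||[x k]].
- exact: enum_uniq.
- by apply: allpairs_uniq => [||[? ?] [? ?]]; rewrite ?enum_uniq.
rewrite mem_enum !inE andbT; apply/idP/allpairsP => /= [xS|[[y l] /= []]].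
  by exists (x, k); rewrite !mem_enum.
by rewrite mem_enum => yS _ [-> _].
Qed.

Lemma perm_filter_copies_enum (X : finType) (U : eqType) (P : pred U) (g : X -> U) n
    (S : {set X}) :
  perm_eq (filter P (flatten [seq nseq n (g x) | x <- enum S]))
          (copies n (map g (enum [set x in S | P (g x)]))).
Proof.
rewrite (map_comp (nseq n) g) -/(copies _ _) filter_copies filter_map.
apply/perm_copies/perm_map; rewrite setIdE perm_sym.
by apply: perm_trans (enum_setI _ _) _; under eq_filter do rewrite inE.
Qed.

Lemma biregular_matching_copies (X Y : finType) (S : {set X}) (T : {set Y})
    (e : X -> Y -> bool) a b dS dT :
    0 < b -> 0 < dS -> a * #|S| = b * #|T| ->
    {in S, forall x, #|[set y in T | e x y]| = dS} ->
    {in T, forall y, #|[set x in S | e x y]| = dT} ->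
  exists M : seq (X * Y),
    [/\ perm_eq (unzip1 M) (copies a (enum S)), perm_eq (unzip2 M) (copies b (enum T))
      & all (fun z => e z.1 z.2) M].
Proof.
move=> b_gt0 dS_gt0 cST degS degT.
have [|||| M [M_S M_T Me]] := @biregular_matching _ _ (setX S [set: 'I_a])
    (setX T [set: 'I_b]) (fun x y => e x.1 y.1) (dS * b) (dT * a).
- by rewrite muln_gt0 dS_gt0.
- by rewrite !cardsX !cardsT !card_ord mulnC cST mulnC.
- case=> x k /setXP[/degS <- _]; rewrite -[b in RHS]card_ord -cardsT -cardsX.
  by apply: eq_card => y; rewrite !inE !andbT.
- case=> y k /setXP[/degT <- _]; rewrite -[a in RHS]card_ord -cardsT -cardsX.
  by apply: eq_card => x; rewrite !inE !andbT.
exists [seq (z.1.1, z.2.1) | z <- M]; split; last by rewrite all_map.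
- apply: perm_trans (perm_copies_enum S a); rewrite /unzip1 -map_comp.
  by rewrite (map_comp fst fst); apply: perm_map.
- apply: perm_trans (perm_copies_enum T b); rewrite /unzip2 -map_comp.
  by rewrite (map_comp fst snd); apply: perm_map.
Qed.

(** * Pairings *)

Definition flatten_pairs (U : Type) (prs : seq (U * U)) :=
  flatten [seq [:: z.1; z.2] | z <- prs].

Definition pairable (U : eqType) (R : rel U) (s : seq U) :=
  exists2 prs : seq (U * U),
    perm_eq (flatten_pairs prs) s & all (fun z => R z.1 z.2) prs.

Lemma perm_pairable (U : eqType) (R : rel U) s1 s2 :
  perm_eq s1 s2 -> pairable R s1 -> pairable R s2.
Proof. by move=> s12 [prs prs_s1 Rprs]; exists prs; rewrite ?(perm_trans prs_s1). Qed.

Lemma pairable_flatten (U : eqType) (R : rel U) (ss : seq (seq U)) :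
  {in ss, forall s, pairable R s} -> pairable R (flatten ss).
Proof.
elim: ss => [|s ss IH] pair_ss; first by exists [::].
have [|prs prs_ss Rprs] := IH.
  by move=> u u_ss; apply: pair_ss; rewrite inE u_ss orbT.
have [prs' prs'_s Rprs'] := pair_ss s (mem_head _ _).
exists (prs' ++ prs); last by rewrite all_cat Rprs'.
by rewrite /flatten_pairs map_cat flatten_cat; apply: perm_cat.
Qed.

Lemma perm_cons_map (U V : eqType) (f : U -> V) v (r : seq V) (s : seq U) :
  perm_eq (v :: r) (map f s) ->
  exists x s', [/\ perm_eq (x :: s') s, v = f x & perm_eq r (map f s')].
Proof.
move=> vr_s; have /mapP[x xs vE] : v \in map f s by rewrite -(perm_mem vr_s) mem_head.
have s_rem := perm_to_rem xs.
exists x, (rem x s); split=> //; first by rewrite perm_sym.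
rewrite -(perm_cons v); apply: perm_trans vr_s _.
by rewrite vE -map_cons perm_map.
Qed.

Lemma pairable_map (U V : eqType) (f : U -> V) (R : rel V) (s : seq U) :
  pairable R (map f s) -> pairable (relpre f R) s.
Proof.
case=> prs; elim: prs s => [|[u v] prs IH] s.
  by move/perm_size; case: s => // _ _; exists [::].
rewrite /flatten_pairs /= -/(flatten_pairs prs).
case/perm_cons_map=> x [s1 [xs1_s -> /perm_cons_map[y [s2 [ys2_s1 -> prs_s2]]]]].
case/andP=> Rxy /(IH _ prs_s2)[ps ps_s2 Rps].
exists ((x, y) :: ps); last by rewrite /= Rxy.
rewrite /flatten_pairs /= (perm_trans _ xs1_s) // perm_cons (perm_trans _ ys2_s1) //.
by rewrite perm_cons.
Qed.

Lemma pairable_unzip (X Y : Type) (U : eqType) (g : X -> U) (h : Y -> U) (R : rel U)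
    (M : seq (X * Y)) :
  all (fun z => R (g z.1) (h z.2)) M ->
  pairable R (map g (unzip1 M) ++ map h (unzip2 M)).
Proof.
move=> RM; exists [seq (g z.1, h z.2) | z <- M]; last by rewrite all_map.
elim: M {RM} => //= z M IH; rewrite /flatten_pairs /= perm_cons.
by rewrite perm_sym perm_catC /= perm_cons perm_catC perm_sym.
Qed.

(** * Pairs of disjoint subsets *)

Lemma exists_subset_card (T : finType) (A : {set T}) k :
  k <= #|A| -> exists2 D : {set T}, D \subset A & #|D| = k.
Proof.
rewrite -bin_gt0 -cards_draws => /card_gt0P[D].
by rewrite inE => /andP[DA /eqP cD]; exists D.
Qed.

Definition disjoint_pairs (T : finType) (A : {set T}) k m :=
  [set P : {set T} * {set T} |
    [&& P.1 \subset A, #|P.1| == k, P.2 \subset A :\: P.1 & #|P.2| == m]].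

Section DisjointPairs.
Variables (T : finType) (A : {set T}).
Implicit Types (B C D : {set T}) (P Q : {set T} * {set T}).

Lemma card_disjoint_pairs k m :
  #|disjoint_pairs A k m| = 'C(#|A|, k) * 'C(#|A| - k, m).
Proof.
pose subsets D j := [set B : {set T} | B \subset D & #|B| == j].
transitivity (\sum_(B in subsets A k) #|subsets (A :\: B) m|).
  under eq_bigr do rewrite -sum1_card.
  by rewrite pair_big_dep -sum1_card; apply: eq_bigl => P; rewrite !inE !andbA.
rewrite -[in RHS]cards_draws -sum_nat_const.
apply: eq_bigr => B; rewrite inE => /andP[BA /eqP <-].
by rewrite cards_draws cardsD (setIidPr BA).
Qed.

Lemma disjoint_pairs0_snd k P : P \in disjoint_pairs A k 0 -> P.2 = set0.
Proof. by rewrite inE cards_eq0 => /and4P[_ _ _ /eqP]. Qed.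

Lemma disjoint_pairs_full_snd k P :
  P \in disjoint_pairs A k (#|A| - k) -> P.2 = A :\: P.1.
Proof.
rewrite inE => /and4P[BA /eqP cB CAB /eqP cC]; apply/eqP.
by rewrite eqEcard CAB cC cardsD (setIidPr BA) cB /=.
Qed.

Lemma perm_enum_disjoint_pairs_fst k m (snd_of : {set T} -> {set T}) :
    k + m <= #|A| ->
    {in disjoint_pairs A k m, forall P, P.2 = snd_of P.1} ->
  perm_eq [seq P.1 | P <- enum (disjoint_pairs A k m)]
          (enum [set B : {set T} | B \subset A & #|B| == k]).
Proof.
move=> kmA sndE; have fst_inj : {in disjoint_pairs A k m &, injective fst}.
  apply: (can_in_inj (g := fun B => (B, snd_of B))) => P PA.
  by rewrite -sndE // -surjective_pairing.
apply: perm_trans (perm_enum_imset fst_inj) _; suff -> : fst @: disjoint_pairs A k m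
    = [set B : {set T} | B \subset A & #|B| == k] by [].
apply/setP => B; rewrite inE; apply/imsetP/andP => [[P]|[BA /eqP cB]].
  by rewrite inE => /and4P[BA cB _ _] ->.
have [C CAB cC] : exists2 C : {set T}, C \subset A :\: B & #|C| = m.
  by apply: exists_subset_card; rewrite cardsD (setIidPr BA) cB; lia.
by exists (B, C); rewrite // inE BA cB CAB cC !eqxx.
Qed.

Lemma notin_disjoint_pairs_snd i k m P :
  i \notin A -> P \in disjoint_pairs A k m -> i \notin P.2.
Proof.
move=> iA; rewrite inE => /and4P[_ _ CAB _]; apply: contra iA.
by move=> /(subsetP CAB)/setDP[].
Qed.

End DisjointPairs.

Section AddPoint.
Variables (T : finType) (i : T).
Implicit Types (A B C : {set T}) (P : {set T} * {set T}).

Definition add_point P : {set T} * {set T} := (P.1, i |: P.2).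

Lemma add_point_inj A k m : i \notin A ->
  {in disjoint_pairs A k m &, injective add_point}.
Proof.
move=> iA [B C] [B' C'] /(notin_disjoint_pairs_snd iA) /= iC.
move=> /(notin_disjoint_pairs_snd iA) /= iC' [<-] CC'.
by rewrite -(setU1K iC) CC' setU1K.
Qed.

Lemma disjoint_pairs_notin_fst A k m : i \in A ->
  [set P in disjoint_pairs A k m.+1 | i \notin P.1]
  = disjoint_pairs (A :\ i) k m.+1 :|: add_point @: disjoint_pairs (A :\ i) k m.
Proof.
move=> iA; apply/setP => -[B C]; rewrite !inE /=.
have -> : ((B, C) \in add_point @: disjoint_pairs (A :\ i) k m)
    = (i \in C) && ((B, C :\ i) \in disjoint_pairs (A :\ i) k m).
  apply/imsetP/andP => [[P PA [-> ->]]|[iC PA]]; last first.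
    by exists (B, C :\ i); rewrite // /add_point /= setD1K.
  rewrite setU11 setU1K -?surjective_pairing //.
  by apply: notin_disjoint_pairs_snd PA; rewrite setD11.
rewrite inE /= !(subsetD1 _ A) !(setDDl A) (setUC [set i]) -!setDDl.
rewrite !(subsetD1 _ (A :\: B)).
case iB: (i \in B); rewrite /= ?andbF //.
have [iC|iC] := boolP (i \in C); last by rewrite !andbT orbF.
rewrite !andbT !andbF setD11 andbT subDset (setUidPr _) ?sub1set ?inE ?iB ?iA //.
by rewrite (cardsD1 i C) iC add1n eqSS.
Qed.

Lemma perm_enum_disjoint_pairs_notin_fst A k m : i \in A ->
  perm_eq (enum [set P in disjoint_pairs A k m.+1 | i \notin P.1])
    ([seq add_point P | P <- enum (disjoint_pairs (A :\ i) k m)]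
     ++ enum (disjoint_pairs (A :\ i) k m.+1)).
Proof.
move=> iA; have iNA : i \notin A :\ i by rewrite setD11.
rewrite perm_sym perm_catC perm_sym disjoint_pairs_notin_fst //.
apply: perm_trans (enum_setU _ _) _; rewrite undup_id; last first.
  rewrite cat_uniq !enum_uniq andbT; apply/hasPn => P.
  rewrite !mem_enum => /imsetP[Q _ ->].
  by apply/negP => /(notin_disjoint_pairs_snd iNA); rewrite setU11.
apply: perm_cat => //; rewrite perm_sym; exact: perm_enum_imset (add_point_inj iNA).
Qed.

Lemma perm_filter_copies_fst (U : eqType) (R : pred U) (g : {set T} -> U)
    (h : {set T} * {set T} -> U) k m n (snd_of : {set T} -> {set T}) :
    k + m <= #|T|.-1 ->
    {in disjoint_pairs [set~ i] k m, forall P, P.2 = snd_of P.1} ->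
    {in disjoint_pairs [set~ i] k m, forall P, h P = g P.1} ->
    (forall B : {set T}, #|B| = k -> R (g B) = (i \notin B)) ->
  perm_eq
    (filter R (flatten [seq nseq n (g B) | B <- enum [set B : {set T} | #|B| == k]]))
    (copies n [seq h P | P <- enum (disjoint_pairs [set~ i] k m)]).
Proof.
move=> km sndE hE RE; apply: perm_trans (perm_filter_copies_enum _ _ _ _) _.
have -> : [seq h P | P <- enum (disjoint_pairs [set~ i] k m)]
    = [seq g B | B <- [seq P.1 | P <- enum (disjoint_pairs [set~ i] k m)]].
  by rewrite -map_comp; apply/eq_in_map => P; rewrite mem_enum => /hE.
apply/perm_copies/perm_map; rewrite perm_sym.
apply: perm_trans (perm_enum_disjoint_pairs_fst _ sndE) _; first by rewrite cardsC1.
suff -> : [set B : {set T} | B \subset [set~ i] & #|B| == k]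
    = [set B in [set B : {set T} | #|B| == k] | R (g B)] by [].
apply/setP => B; rewrite !inE andbC subsetC sub1set inE.
by apply: andb_id2l => /eqP /RE.
Qed.

End AddPoint.

Section Symmetry.
Variable T : finType.
Implicit Types (A B C D : {set T}) (P Q : {set T} * {set T}) (s : {perm T}).

Lemma exists_perm_comp (K : eqType) (f g : {ffun T -> K}) :
    (forall c, #|[set x | f x == c]| = #|[set x | g x == c]|) ->
  exists s : {perm T}, forall x, f x = g (s x).
Proof.
move=> fg; have count_fgraph (h : {ffun T -> K}) c :
    count_mem c (fgraph h) = #|[set x | h x == c]|.
  rewrite fgraph_codom count_map -size_filter cardE enumT; congr size.
  by apply: eq_filter => x; exact: esym (in_set _ _).
have /tuple_permP[u fE] : perm_eq (fgraph f) (fgraph g).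
  by apply/allP => c _ /=; rewrite !count_fgraph fg.
have sinj : injective (fun x => enum_val (u (enum_rank x))).
  by move=> x y /enum_val_inj/perm_inj/enum_rank_inj.
exists (perm sinj) => x; rewrite permE.
have := congr1 (fun t : #|T|.-tuple K => tnth t (enum_rank x)) (val_inj fE).
by rewrite tnth_mktuple !tnth_fgraph enum_rankK.
Qed.

Definition perm_pair s P : {set T} * {set T} := (s @: P.1, s @: P.2).

Definition pair_color A P := [ffun x => (x \in A, x \in P.1, x \in P.2)].

Lemma card_pair_color A k m P c : P \in disjoint_pairs A k m ->
  #|[set x | pair_color A P x == c]| = match c with
    | (true, true, false) => k
    | (true, false, true) => m
    | (true, false, false) => #|A| - k - m
    | (false, false, false) => #|~: A|
    | _ => 0
    end.
Proof.
case: P => B C; rewrite inE /= => /and4P[BA /eqP <- CAB /eqP <-].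
have B_A x : (x \in B) ==> (x \in A) by apply/implyP/subsetP.
have C_AB x : (x \in C) ==> (x \in A) && (x \notin B).
  by apply/implyP => /(subsetP CAB)/setDP[-> ->].
have <- : #|A :\: B :\: C| = #|A| - #|B| - #|C|.
  by rewrite cardsD (setIidPr CAB) cardsD (setIidPr BA).
have color_class D : (forall x, (pair_color A (B, C) x == c) = (x \in D)) ->
    #|[set x | pair_color A (B, C) x == c]| = #|D|.
  by move=> DE; apply: eq_card => x; rewrite inE.
case: c color_class => [[[] []] []] color_class; rewrite -?(cards0 T);
  apply: color_class => x; rewrite ffunE !xpair_eqE ?inE /=;
  by move: (B_A x) (C_AB x); case: (x \in A); case: (x \in B); case: (x \in C).
Qed.

Lemma exists_perm_disjoint_pairs A k m P Q :
    P \in disjoint_pairs A k m -> Q \in disjoint_pairs A k m ->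
  exists2 s : {perm T}, s @: A = A & perm_pair s P = Q.
Proof.
move=> PA QA; have [|s colorE] := @exists_perm_comp _ (pair_color A P) (pair_color A Q).
  by move=> c; rewrite !(card_pair_color (k := k) (m := m)).
have {}colorE x : [/\ (x \in A) = (s x \in A), (x \in P.1) = (s x \in Q.1)
    & (x \in P.2) = (s x \in Q.2)] by move: (colorE x); rewrite !ffunE => -[].
have im_s D D' : (forall x, (x \in D) = (s x \in D')) -> s @: D = D'.
  move=> DE; apply/setP => y.
  by rewrite -(permKV s y) mem_imset ?DE //; apply: perm_inj.
exists s; first by apply: im_s => x; case: (colorE x).
by case: Q {QA} colorE => B C colorE; congr (_, _); apply: im_s => x; case: (colorE x).
Qed.

Lemma perm_pair_inj s : injective (perm_pair s).
Proof. by move=> [B C] [B' C'] [/(imset_inj perm_inj) -> /(imset_inj perm_inj) ->]. Qed.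

Lemma mem_perm_pair A k m s P : s @: A = A ->
  (perm_pair s P \in disjoint_pairs A k m) = (P \in disjoint_pairs A k m).
Proof.
move=> sA; have sinj := @perm_inj _ s.
have subE D D' : (s @: D \subset s @: D') = (D \subset D').
  apply/idP/idP; last exact: imsetS.
  move=> /subsetP sub; apply/subsetP => x xD.
  by have := sub _ (imset_f s xD); rewrite mem_imset.
have imD D D' : s @: (D :\: D') = s @: D :\: s @: D'.
  by apply/setP => x; rewrite -(permKV s x) inE !(mem_imset _ _ sinj) inE.
by rewrite !inE /= !card_imset // -{1 2}sA -imD !subE.
Qed.

Definition compatible P Q :=
  [forall x, ((x \in P.2) != (x \in Q.2)) ==> (x \in P.1 :|: Q.1)].

Lemma compatible_sym : symmetric compatible.
Proof. by move=> P Q; apply: eq_forallb => x; rewrite eq_sym setUC. Qed.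

Lemma compatible_perm_pair s P Q :
  compatible P Q -> compatible (perm_pair s P) (perm_pair s Q).
Proof.
move=> /forallP compPQ; apply/forallP => y; rewrite -(permKV s y) /= -imsetU.
by rewrite !(mem_imset _ _ (@perm_inj _ s)).
Qed.

Lemma card_compatible A k m k' m' P Q :
    P \in disjoint_pairs A k m -> Q \in disjoint_pairs A k m ->
  #|[set P' in disjoint_pairs A k' m' | compatible P P']|
  = #|[set Q' in disjoint_pairs A k' m' | compatible Q Q']|.
Proof.
move=> PA QA; apply/eqP; rewrite eqn_leq.
wlog suff leq_card : P Q PA QA /
    #|[set P' in disjoint_pairs A k' m' | compatible P P']|
    <= #|[set Q' in disjoint_pairs A k' m' | compatible Q Q']|.
  by rewrite !leq_card.
have [s sA <-] := exists_perm_disjoint_pairs PA QA.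
rewrite -(card_imset _ (@perm_pair_inj s)); apply: subset_leq_card.
apply/subsetP => _ /imsetP[P' /setIdP[P'A compPP'] ->].
by rewrite inE mem_perm_pair // P'A compatible_perm_pair.
Qed.

Lemma exists_compatible A k m k' m' :
    m' <= k + m <= k' + m' -> k' + m' <= #|A| ->
  exists P Q,
    [/\ P \in disjoint_pairs A k m, Q \in disjoint_pairs A k' m' & compatible P Q].
Proof.
move=> /andP[m'_le le_km] le_A.
have [D DA cD] := exists_subset_card le_A.
have [|E ED cE] := @exists_subset_card _ D (k + m); first by rewrite cD.
have [|B BE cB] := @exists_subset_card _ E k; first by lia.
have [|C CE cC] := @exists_subset_card _ E m'; first by lia.
have CD := subset_trans CE ED.
exists (B, E :\: B), (D :\: C, C); split; rewrite ?inE /=.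
- have EA := subset_trans ED DA; rewrite (subset_trans BE EA) (setSD _ EA).
  by rewrite cardsD (setIidPr BE) cE cB addKn !eqxx.
- rewrite (subset_trans _ DA) ?subsetDl // cardsD (setIidPr CD) cD cC addnK.
  rewrite subsetD (subset_trans CD DA) disjoint_sym disjoints_subset.
  by rewrite setDE subsetIr !eqxx.
apply/forallP => x; apply/implyP; rewrite !inE /=.
have /implyP := subsetP ED x; have /implyP := subsetP CE x.
by case: (x \in B); case: (x \in C); case: (x \in E); case: (x \in D).
Qed.

End Symmetry.

Lemma disjoint_pairs_matching (T : finType) (A : {set T}) k m k' m' a b :
    0 < b -> m' <= k + m <= k' + m' -> k' + m' <= #|A| ->
    a * ('C(#|A|, k) * 'C(#|A| - k, m)) = b * ('C(#|A|, k') * 'C(#|A| - k', m')) ->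
  exists M : seq (({set T} * {set T}) * ({set T} * {set T})),
    [/\ perm_eq (unzip1 M) (copies a (enum (disjoint_pairs A k m))),
        perm_eq (unzip2 M) (copies b (enum (disjoint_pairs A k' m')))
      & all (fun z => compatible z.1 z.2) M].
Proof.
move=> b_gt0 le_sizes le_A card_eq.
have [P0 [Q0 [P0A Q0A comp0]]] := exists_compatible le_sizes le_A.
apply: (biregular_matching_copies (e := @compatible T)
    (dS := #|[set Q in disjoint_pairs A k' m' | compatible P0 Q]|)
    (dT := #|[set P in disjoint_pairs A k m | compatible Q0 P]|) b_gt0).
- by apply/card_gt0P; exists Q0; rewrite inE Q0A.
- by rewrite !card_disjoint_pairs.
- by move=> P PA; apply: card_compatible PA P0A.
move=> Q QA; rewrite (card_compatible k m Q0A QA).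
by apply: eq_card => P; rewrite !inE (compatible_sym P).
Qed.

(** * Columns *)

Local Open Scope ring_scope.

Section Columns.
Variables (F : fieldType) (p : nat).
Implicit Types (i j : 'I_p) (B C : {set 'I_p}) (P Q : {set 'I_p} * {set 'I_p}).

Definition sum_xb C : 'rV[F]_p := \sum_(c in C) xb F c.

Lemma sum_xbE C j : sum_xb C 0 j = (j \in C)%:R.
Proof.
have xbE c : xb F c 0 j = (c == j)%:R by rewrite mxE eq_sym.
rewrite summxE (eq_bigr _ (fun c _ => xbE c)); have [jC|jC] := boolP (j \in C).
  rewrite (bigD1 j jC) /= eqxx big1 ?addr0 // => c /andP[_ /negPf ->] //.
by rewrite big1 // => c cC; case: eqP jC => // <-; rewrite cC.
Qed.

Lemma sum_xb_inj : injective sum_xb.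
Proof.
move=> C C' CC'; apply/setP => j; have := congr1 (fun u : 'rV_p => u 0 j) CC'.
by rewrite !sum_xbE => /eqP; do 2!case: (_ \in _); rewrite ?oner_eq0 // eq_sym oner_eq0.
Qed.

Lemma sum_xb1 i : sum_xb [set i] = xb F i.
Proof. exact: big_set1. Qed.

Lemma xb_inj : injective (@xb F p).
Proof. by move=> i j; rewrite -!sum_xb1 => /sum_xb_inj/set1_inj. Qed.

Definition singletons B : seq 'rV[F]_p := [seq xb F b | b <- enum B].

Lemma mem_singletons i B : (xb F i \in singletons B) = (i \in B).
Proof. by rewrite mem_map ?mem_enum //; apply: xb_inj. Qed.

Definition column P : seq 'rV[F]_p :=
  singletons P.1 ++ (if P.2 == set0 then [::] else [:: sum_xb P.2]).

Lemma column_rcons P : P.2 != set0 -> column P = rcons (singletons P.1) (sum_xb P.2).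
Proof. by rewrite /column => /negPf ->; rewrite cats1. Qed.

Lemma mem_column i P : (xb F i \in column P) = (i \in P.1) || (P.2 == [set i]).
Proof.
rewrite mem_cat mem_singletons; congr orb; case: ifPn => [/eqP ->|_].
  by rewrite in_nil eq_sym -cards_eq0 cards1.
by rewrite inE -sum_xb1 (inj_eq sum_xb_inj) eq_sym.
Qed.

Lemma singleton_column_span b P (V : seq 'rV[F]_p) :
  b \in P.1 -> {subset column P <= V} -> xb F b \in <<V>>%VS.
Proof. by move=> bP PV; apply: memv_span; apply: PV; rewrite mem_column bP. Qed.

Lemma sum_column_span P (V : seq 'rV[F]_p) :
  {subset column P <= V} -> sum_xb P.2 \in <<V>>%VS.
Proof.
move=> PV; have [->|P0] := eqVneq P.2 set0; first by rewrite /sum_xb big_set0 mem0v.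
by apply: memv_span; apply: PV; rewrite mem_cat (negPf P0) inE eqxx orbT.
Qed.

Lemma sum_xbB_mem (V : {vspace 'rV[F]_p}) C C' :
  (forall c, (c \in C) != (c \in C') -> xb F c \in V) -> sum_xb C - sum_xb C' \in V.
Proof.
move=> CC'V; rewrite /sum_xb big_mkcond [X in _ - X]big_mkcond -sumrB.
apply: memv_suml => c _; have := CC'V c.
by do 2!case: (c \in _); rewrite ?subrr ?subr0 ?sub0r ?memvN ?mem0v //; apply.
Qed.

Definition recovers i (u v : seq 'rV[F]_p) := xb F i \in <<u ++ v>>%VS.

Lemma recovers_compatible i P Q :
    i \notin Q.2 -> compatible P Q -> recovers i (column P) (column (add_point i Q)).
Proof.
rewrite /recovers; move=> iQ /forallP compPQ; set V := <<_>>%VS.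
have PV : {subset column P <= column P ++ column (add_point i Q)}.
  by move=> u uP; rewrite mem_cat uP.
have QV : {subset column (add_point i Q) <= column P ++ column (add_point i Q)}.
  by move=> u uQ; rewrite mem_cat uQ orbT.
have -> : xb F i = sum_xb (i |: Q.2) - sum_xb P.2 + (sum_xb P.2 - sum_xb Q.2).
  by rewrite subrKA /sum_xb big_setU1 //= addrK.
apply: memvD; first exact: memvB (sum_column_span QV) (sum_column_span PV).
apply: sum_xbB_mem => c PQc; have := compPQ c; rewrite PQc inE => /orP[cP|cQ].
  exact: singleton_column_span cP PV.
exact: singleton_column_span (cQ : c \in (add_point i Q).1) QV.
Qed.

Definition avoiding_columns i n k m :=
  copies n [seq column P | P <- enum (disjoint_pairs [set~ i] k m)].

Definition summing_columns i n k m :=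
  copies n [seq column (add_point i P) | P <- enum (disjoint_pairs [set~ i] k m)].

Lemma pairable_columns i k m k' m' a b :
    (0 < b)%N -> (m' <= k + m <= k' + m')%N -> (k' + m' < p)%N ->
    (a * ('C(p.-1, k) * 'C(p.-1 - k, m))
     = b * ('C(p.-1, k') * 'C(p.-1 - k', m')))%N ->
  pairable (recovers i) (avoiding_columns i a k m ++ summing_columns i b k' m').
Proof.
move=> b_gt0 le_sizes lt_p card_eq.
have cA : #|[set~ i]| = p.-1 by rewrite cardsC1 card_ord.
have [|| M [M_avoid M_sum M_comp]] :=
  disjoint_pairs_matching (A := [set~ i]) (a := a) b_gt0 le_sizes.
- by rewrite cA; lia.
- by rewrite cA.
rewrite /avoiding_columns /summing_columns -!map_copies.
apply: perm_pairable (perm_cat (perm_map _ M_avoid) (perm_map _ M_sum)) _.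
apply: pairable_unzip; apply/allP => z zM; apply: recovers_compatible (allP M_comp z zM).
have : z.2 \in unzip2 M by apply: map_f.
rewrite (perm_mem M_sum) => /flattenP[_ /mapP[Q + ->]]; rewrite mem_enum mem_nseq.
move=> QA /andP[_ /eqP ->].
by apply: notin_disjoint_pairs_snd QA; rewrite !inE eqxx.
Qed.

End Columns.

(** * The array code *)

Lemma flatten_iota_shift (U : Type) (L R : nat -> seq U) a n :
  L a ++ flatten [seq R r ++ L r | r <- iota a.+1 n] ++ R (a + n).+1
  = flatten [seq L r ++ R r.+1 | r <- iota a n.+1].
Proof.
elim: n a => [|n IH] a; first by rewrite addn0 /= cats0.
have -> : flatten [seq L r ++ R r.+1 | r <- iota a n.+2] =
    (L a ++ R a.+1) ++ flatten [seq L r ++ R r.+1 | r <- iota a.+1 n.+1] by [].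
by rewrite -IH /= addSnnS -!catA.
Qed.

Lemma perm_flatten_map (I U : eqType) (f g : I -> seq U) (s : seq I) :
  {in s, forall r, perm_eq (f r) (g r)} ->
  perm_eq (flatten (map f s)) (flatten (map g s)).
Proof.
elim: s => //= r s IH fg; apply: perm_cat; first by apply: fg; rewrite mem_head.
by apply: IH => k ks; apply: fg; rewrite inE ks orbT.
Qed.

Section ArrayCode.
Variables (F : fieldType) (p : nat) (i : 'I_p).

Lemma filter_cols_T1 t xi : (t < p)%N ->
  perm_eq [seq u <- cols_T1 F p t xi | xb F i \notin u]
          (avoiding_columns F i (xi 1%N) t 0).
Proof.
move=> tp; apply: (perm_filter_copies_fst _ (snd_of := fun=> set0)).
- by rewrite addn0 card_ord; lia.
- exact: disjoint_pairs0_snd.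
- by move=> P /disjoint_pairs0_snd P0; rewrite /column P0 eqxx cats0.
by move=> B _; rewrite mem_singletons.
Qed.

Lemma filter_cols_Tr t xi r : (0 < r.-1 * t)%N ->
  perm_eq [seq u <- cols_Tr F p t xi r | xb F i \notin u]
    (summing_columns F i (xi r) t.-1 (r.-1 * t)%N
     ++ avoiding_columns F i (xi r) t.-1 (r.-1 * t).+1).
Proof.
move=> rt_gt0; set m := (r.-1 * t)%N in rt_gt0 *.
have -> : cols_Tr F p t xi r
    = flatten [seq nseq (xi r) (column F P) | P <- enum (disjoint_pairs setT t.-1 m.+1)].
  rewrite /cols_Tr; congr flatten; rewrite -/m.
  have -> : [set BC : {set 'I_p} * {set 'I_p} |
      [&& #|BC.1| == t.-1, #|BC.2| == m.+1 & [disjoint BC.1 & BC.2]]]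
      = disjoint_pairs setT t.-1 m.+1.
    apply/setP => P; rewrite !inE subsetT setTD -disjoints_subset disjoint_sym /=.
    by congr andb; rewrite andbC.
  apply/eq_in_map => P; rewrite mem_enum inE => /and4P[_ _ _ /eqP cP].
  by rewrite column_rcons // -card_gt0 cP.
apply: perm_trans (perm_filter_copies_enum _ _ _ _) _.
rewrite -copies_cat; apply: perm_copies.
have -> : [set P in disjoint_pairs setT t.-1 m.+1 | xb F i \notin column F P]
    = [set P in disjoint_pairs setT t.-1 m.+1 | i \notin P.1].
  apply/setP => P; rewrite inE [RHS]inE mem_column; apply: andb_id2l; rewrite inE.
  move=> /and4P[_ _ _ /eqP cP]; case: eqP => [P2|_]; last by rewrite orbF.
  by move: cP; rewrite P2 cards1 => -[] E; rewrite -E in rt_gt0.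
rewrite (map_comp (@column F p) (add_point i)) -map_cat; apply: perm_map.
by rewrite -setTD; apply: perm_enum_disjoint_pairs_notin_fst.
Qed.

Lemma filter_cols_Tq t xi q : (0 < t < p)%N ->
  perm_eq [seq u <- cols_Tq F p t xi q | xb F i \notin u]
          (summing_columns F i (xi q) t.-1 (p - t)%N).
Proof.
move=> /andP[t_gt0 tp]; have cA : #|[set~ i]| = p.-1 by rewrite cardsC1 card_ord.
have sndE : {in disjoint_pairs [set~ i] t.-1 (p - t)%N,
    forall P, P.2 = [set~ i] :\: P.1}.
  have -> : (p - t = #|[set~ i]| - t.-1)%N by rewrite cA; lia.
  by move=> P; apply: disjoint_pairs_full_snd.
apply: (perm_filter_copies_fst _ _ sndE) => [|P PA|B cB].
- by rewrite card_ord; lia.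
- have iP : i \notin P.1 by move: PA; rewrite inE subsetC sub1set inE => /andP[].
  rewrite column_rcons /=; last by apply/set0Pn; exists i; rewrite setU11.
  congr rcons; congr sum_xb; apply/setP => j; rewrite (sndE P PA) !inE.
  by case: eqP => [->|] //=; rewrite andbT.
have cBC : (1 < #|~: B|)%N by rewrite cardsCs setCK cB card_ord; lia.
have BC0 : ~: B != set0 by rewrite -card_gt0 ltnW.
rewrite -(@column_rcons F p (B, ~: B)) // mem_column /=.
by case: eqP cBC => [->|]; rewrite ?cards1 ?orbF.
Qed.

Variables (t q : nat) (xi : nat -> nat).
Hypotheses (t_gt1 : (1 < t)%N) (q_gt2 : (2 < q)%N).
Hypothesis p_bounds : (q.-1 * t < p < q * t)%N.

Definition singletons_card r := if r == 1%N then t else t.-1.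

Definition summands_card r := if r == 1%N then 0%N else (r.-1 * t).+1.

(* The number of terms other than x_i in the sum of a column of type T_r, r > 1: the sum
   has (r - 1) * t + 1 terms if r < q, and p - t + 1 if r = q. *)
Definition other_summands_card r := minn (r.-1 * t) (p - t).

Definition avoiding_type r :=
  avoiding_columns F i (xi r) (singletons_card r) (summands_card r).

Definition summing_type r := summing_columns F i (xi r) t.-1 (other_summands_card r).

Lemma filter_array_code :
  perm_eq [seq u <- array_code F p t q xi | xb F i \notin u]
    (flatten [seq avoiding_type r ++ summing_type r.+1 | r <- iota 1 q.-1]).
Proof.
have -> : q.-1 = (q - 2).+1 by lia.
rewrite -flatten_iota_shift /array_code !filter_cat; apply: perm_cat.
  by apply: filter_cols_T1; nia.
apply: perm_cat.
  rewrite filter_flatten -map_comp; apply: perm_flatten_map => r.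
  rewrite mem_iota => r_range; rewrite /avoiding_type /singletons_card /summands_card.
  rewrite gtn_eqF; last by lia.
  rewrite /summing_type /other_summands_card (minn_idPl _); last by nia.
  by apply: filter_cols_Tr; nia.
have -> : (1 + (q - 2)).+1 = q by lia.
rewrite /summing_type /other_summands_card (minn_idPr _); last by nia.
by apply: filter_cols_Tq; nia.
Qed.

Hypothesis xi_gt0 : forall r, (1 <= r <= q)%N -> (0 < xi r)%N.
Hypothesis xi1 : ((p - t) * xi 1 = t * 'C(p - t, t) * xi 2)%N.
Hypothesis xi_rec : forall r, (2 <= r <= q - 2)%N ->
  ('C(p - t, (r - 1) * t + 1) * xi r = 'C(p - t, r * t) * xi r.+1)%N.
Hypothesis xi_last : (xi q.-1 * 'C(p - t, (q - 2) * t + 1) = xi q)%N.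

Lemma multiplicity_balance r : (1 <= r < q)%N ->
  (xi r * ('C(p.-1, singletons_card r) * 'C(p.-1 - singletons_card r, summands_card r))
   = xi r.+1 * ('C(p.-1, t.-1) * 'C(p.-1 - t.-1, other_summands_card r.+1)))%N.
Proof.
move=> r_range; have ptE : (p.-1 - t.-1 = p - t)%N by nia.
rewrite /singletons_card /summands_card /other_summands_card ptE /=.
have [->|r1] := eqVneq r 1%N.
  have binE : (t * 'C(p.-1, t) = (p - t) * 'C(p.-1, t.-1))%N.
    by have := mul_bin_left p.-1 t.-1; rewrite prednK ?ptE // ltnW.
  apply/eqP; rewrite bin0 muln1 mul1n (minn_idPl _); last by nia.
  rewrite -(eqn_pmul2l (ltnW t_gt1)); apply/eqP.
  by rewrite mulnCA binE !mulnA [(xi 1 * _)%N]mulnC xi1; lia.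
rewrite ptE mulnCA [RHS]mulnCA; congr (_ * _)%N.
have [rq|rq] := eqVneq r.+1 q.
  rewrite (minn_idPr _); last by nia.
  by rewrite binn muln1 rq -xi_last -rq; congr (_ * 'C(_, _))%N; lia.
rewrite (minn_idPl _); last by nia.
by rewrite mulnC [RHS]mulnC -xi_rec ?subn1 ?addn1 //; lia.
Qed.

Lemma pairable_consecutive_types r : (1 <= r < q)%N ->
  pairable (recovers i) (avoiding_type r ++ summing_type r.+1).
Proof.
move=> r_range; have rE : (r * t = r.-1 * t + t)%N by nia.
have rt : (r * t <= q.-1 * t)%N by rewrite leq_mul2r; lia.
apply: pairable_columns; last exact: multiplicity_balance.
- by apply: xi_gt0; lia.
- by rewrite /singletons_card /summands_card /other_summands_card; case: eqP => /= ?; lia.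
by rewrite /other_summands_card /=; lia.
Qed.

End ArrayCode.

Lemma ltn_mul_ceil (R : archiRealFieldType) (s : R) (t p q : nat) :
    s \isn't a Num.int -> (0 < t)%N -> (0 < q)%N -> p%:R = s * t%:R ->
    q%:Z = Num.ceil s ->
  (q.-1 * t < p < q * t)%N.
Proof.
move=> s_nint t_gt0 q_gt0 pE qE; have := ceil_itv s; rewrite -qE => /andP[q1_lt s_le].
have t_gt0R : 0 < t%:R :> R by rewrite ltr0n.
rewrite -2!(ltr_nat R) !natrM pE !ltr_pM2r //; apply/andP; split.
  by rewrite -subn1 natrB //; rewrite intrB in q1_lt.
by rewrite lt_neqAle s_le andbT; apply: contraNneq s_nint => ->; apply: natr_int.
Qed.

Theorem theorem11 (F : finFieldType) (s : rat) (t p q : nat) (xi : nat -> nat)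
  (hs2 : 2 < s) (hsint : s \isn't a Num.int)
  (ht : (1 < t)%N) (hp : p%:R = s * t%:R) (hq : q%:Z = Num.ceil s)
  (hxi_pos : forall r, (1 <= r <= q)%N -> (0 < xi r)%N)
  (hxq : (xi q.-1 * 'C(p - t, (q - 2) * t + 1) = xi q)%N)
  (hxr : forall r, (2 <= r <= q - 2)%N ->
     ('C(p - t, (r - 1) * t + 1) * xi r = 'C(p - t, r * t) * xi r.+1)%N)
  (hx1 : ((p - t) * xi 1%N = t * 'C(p - t, t) * xi 2%N)%N) :
  let C := array_code F p t q xi in
  forall i : 'I_p,
  exists pairs : seq (nat * nat),
    perm_eq (flatten [seq [:: pr.1; pr.2] | pr <- pairs])
            [seq j <- iota 0 (size C) | xb F i \notin nth [::] C j]
    /\ all (fun pr => xb F i \in <<nth [::] C pr.1 ++ nth [::] C pr.2>>%VS)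
           pairs.
Proof.
move=> C i.
have q_gt2 : (2 < q)%N by rewrite -ltz_nat hq ceil_gt_int.
have p_bounds := ltn_mul_ceil hsint (ltnW ht) (ltnW (ltnW q_gt2)) hp hq.
have : pairable (recovers i) [seq u <- C | xb F i \notin u].
  have filterE := filter_array_code F i xi ht q_gt2 p_bounds.
  rewrite perm_sym in filterE; apply: perm_pairable filterE _.
  apply: pairable_flatten => _ /mapP[r + ->]; rewrite mem_iota => r_range.
  apply: (pairable_consecutive_types F i ht q_gt2 p_bounds hxi_pos hx1 hxr hxq).
  by lia.
rewrite -{1}(mkseq_nth [::] C) filter_map => /pairable_map[pairs pairsE pairs_span].
by exists pairs.
Qed.
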